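(* Let $K$ be a field and $R=K[x_{ij},y_k : 1\le i<j\le 4,\ 1\le k\le 4]$ a polynomial ring. Put $$g_{14}=x_{12}y_2+x_{13}y_3+x_{14}y_4,\quad g_{24}=-x_{12}y_1+x_{23}y_3+x_{24}y_4,$$ $$g_{34}=-x_{13}y_1-x_{23}y_2+x_{34}y_4,\quad g_{44}=-x_{14}y_1-x_{24}y_2-x_{34}y_3,$$ $$g_{13}=x_{12}y_2+x_{13}y_3,\quad g_{23}=-x_{12}y_1+x_{23}y_3,\quad g_{33}=-x_{13}y_1-x_{23}y_2,$$ and let $I_4=\langle g_{14},g_{24},g_{34}\rangle$ and $J_4=\langle g_{44}\rangle$. Then $(I_4:J_4)=\langle g_{13},g_{23},g_{33},y_4\rangle$.
   Context: The polynomials $g_{14},g_{24},g_{34},g_{44}$ are the entries of $X_4Y_4$, where $X_4$ is the generic skew-symmetric $4\times 4$ matrix with $(i,j)$ entry $x_{ij}$ for $i<j$, and $Y_4=(y_1,y_2,y_3,y_4)^T$. The colon ideal is $(I:J)=\{p\in R: pJ\subseteq I\}$. *)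

(* Defs.v *)
From HB Require Import structures.
From mathcomp Require Import all_boot all_order all_algebra.
From mathcomp Require Import mpoly.
Set Implicit Arguments.
Unset Strict Implicit.
Unset Printing Implicit Defensive.
Import GRing.Theory.
Local Open Scope ring_scope.

(* Ideals are Prop-valued predicates: MathComp's idealr structure is for       *)
(* boolean predicates, and it has no ideal generated by a family.              *)
Definition ideal_gen (A : comNzRingType) (s : seq A) (p : A) : Prop :=
  exists c : 'I_(size s) -> A, p = \sum_(i < size s) c i * s`_i.

Definition colon (A : comNzRingType) (I J : A -> Prop) (p : A) : Prop :=
  forall q : A, J q -> I (p * q).

(* K[x_ij, y_k] is {mpoly K[10]}, with the variables numbered in the order     *)
(* x12, x13, x14, x23, x24, x34, y1, y2, y3, y4.                               *)
Definition x12 {K : fieldType} : {mpoly K[10]} := 'X_(@Ordinal 10 0 isT).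
Definition x13 {K : fieldType} : {mpoly K[10]} := 'X_(@Ordinal 10 1 isT).
Definition x14 {K : fieldType} : {mpoly K[10]} := 'X_(@Ordinal 10 2 isT).
Definition x23 {K : fieldType} : {mpoly K[10]} := 'X_(@Ordinal 10 3 isT).
Definition x24 {K : fieldType} : {mpoly K[10]} := 'X_(@Ordinal 10 4 isT).
Definition x34 {K : fieldType} : {mpoly K[10]} := 'X_(@Ordinal 10 5 isT).
Definition y1 {K : fieldType} : {mpoly K[10]} := 'X_(@Ordinal 10 6 isT).
Definition y2 {K : fieldType} : {mpoly K[10]} := 'X_(@Ordinal 10 7 isT).
Definition y3 {K : fieldType} : {mpoly K[10]} := 'X_(@Ordinal 10 8 isT).
Definition y4 {K : fieldType} : {mpoly K[10]} := 'X_(@Ordinal 10 9 isT).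

Definition g14 {K : fieldType} : {mpoly K[10]} :=
  x12 * y2 + x13 * y3 + x14 * y4.
Definition g24 {K : fieldType} : {mpoly K[10]} :=
  - x12 * y1 + x23 * y3 + x24 * y4.
Definition g34 {K : fieldType} : {mpoly K[10]} :=
  - x13 * y1 - x23 * y2 + x34 * y4.
Definition g44 {K : fieldType} : {mpoly K[10]} :=
  - x14 * y1 - x24 * y2 - x34 * y3.

Definition g13 {K : fieldType} : {mpoly K[10]} := x12 * y2 + x13 * y3.
Definition g23 {K : fieldType} : {mpoly K[10]} := - x12 * y1 + x23 * y3.
Definition g33 {K : fieldType} : {mpoly K[10]} := - x13 * y1 - x23 * y2.

Definition I4 (K : fieldType) : {mpoly K[10]} -> Prop :=
  ideal_gen [:: g14; g24; g34].
Definition J4 (K : fieldType) : {mpoly K[10]} -> Prop := ideal_gen [:: g44].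

(* Main.v *)
(* Setting y4 = 0 turns g14, g24, g34 into g13, g23, g33, which up to sign are
   the 2x2 minors of the matrix with rows (x23, -x13, x12) and (y1, y2, y3).
   These minors generate the kernel of the map making the first row a multiple
   of the second. So <g13, g23, g33, y4> is the kernel of a map to a domain,
   which kills I4 but not g44, and the colon ideal lies in that kernel. *)
Require Import Defs.
From HB Require Import structures.
From mathcomp Require Import all_boot all_order all_algebra.
From mathcomp Require Import mpoly.
From mathcomp Require Import ring zify.
Set Implicit Arguments.
Unset Strict Implicit.
Unset Printing Implicit Defensive.
Import GRing.Theory.
Local Open Scope ring_scope.

(** * Membership in finitely generated ideals *)

Lemma ideal_gen_nil (A : comNzRingType) (p : A) : ideal_gen [::] p <-> p = 0.
Proof.
split=> [[c ->]|->]; first by rewrite big_ord0.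
by exists (fun=> 0); rewrite big_ord0.
Qed.

(** Peeling off one generator at a time yields named coefficients instead of a function on
    ['I_(size s)]. *)
Lemma ideal_gen_cons (A : comNzRingType) (a : A) (s : seq A) (p : A) :
  ideal_gen (a :: s) p <-> exists c r, ideal_gen s r /\ p = c * a + r.
Proof.
split=> [[c ->]|[c [_ [[d ->] ->]]]].
  exists (c ord0), (\sum_(i < size s) c (lift ord0 i) * s`_i).
  by split; [exists (fun i => c (lift ord0 i)) | rewrite big_ord_recl].
exists (fun i => if unlift ord0 i is Some j then d j else c).
rewrite big_ord_recl unlift_none /=; congr (_ + _).
by apply: eq_bigr => i _; rewrite liftK.
Qed.

Section IdealGenClosure.
Variables (A : comNzRingType) (s : seq A).

Lemma ideal_gen0 : ideal_gen s 0.
Proof. by exists (fun=> 0); rewrite big1 // => i _; rewrite mul0r. Qed.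

Lemma ideal_genD p q : ideal_gen s p -> ideal_gen s q -> ideal_gen s (p + q).
Proof.
move=> [c ->] [d ->]; exists (fun i => c i + d i).
by rewrite -big_split; apply: eq_bigr => i _; rewrite mulrDl.
Qed.

Lemma ideal_genM a p : ideal_gen s p -> ideal_gen s (a * p).
Proof.
move=> [c ->]; exists (fun i => a * c i).
by rewrite mulr_sumr; apply: eq_bigr => i _; rewrite mulrA.
Qed.

Lemma ideal_genN p : ideal_gen s p -> ideal_gen s (- p).
Proof. by rewrite -mulN1r; apply: ideal_genM. Qed.

Lemma ideal_gen_sum (I : eqType) (r : seq I) (F : I -> A) :
  (forall i, i \in r -> ideal_gen s (F i)) -> ideal_gen s (\sum_(i <- r) F i).
Proof.
move=> sF; rewrite big_seq; apply: (big_ind (ideal_gen s)) => //.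
  exact: ideal_gen0.
exact: ideal_genD.
Qed.

Lemma ideal_gen_nth i : ideal_gen s s`_i.
Proof.
have [lti|lei] := ltnP i (size s); last by rewrite nth_default //; apply: ideal_gen0.
exists (fun j => (j == Ordinal lti)%:R).
rewrite (bigD1 (Ordinal lti)) //= eqxx mul1r big1 ?addr0 // => j /negPf->.
by rewrite mul0r.
Qed.

End IdealGenClosure.

(** * Kernels of maps sending monomials to multiples of monomials *)

(** Modulo the ideal, [p] agrees with [Psi (phi p)], where [Psi] extends [psi] linearly; hence
    [phi p = 0] forces membership. *)
Lemma mpoly_monomial_map_ker (K : fieldType) (n k : nat)
    (phi : {linear {mpoly K[n]} -> {mpoly K[k]}}) (s : seq {mpoly K[n]})
    (c : 'X_{1..n} -> K) (f : 'X_{1..n} -> 'X_{1..k})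
    (psi : 'X_{1..k} -> {mpoly K[n]}) :
    (forall m, phi 'X_[m] = c m *: 'X_[f m]) ->
    (forall m, ideal_gen s ('X_[m] - c m *: psi (f m))) ->
  forall p, phi p = 0 -> ideal_gen s p.
Proof.
move=> phiX sX p phip0.
(* [S] lists once each monomial that can occur in [phi p], which makes [Psi] a finite sum. *)
pose S := undup [seq f m | m <- msupp p].
pose Psi (q : {mpoly K[k]}) := \sum_(m <- S) q@_m *: psi m.
have Psi_phi : Psi (phi p) = \sum_(m <- msupp p) p@_m *: (c m *: psi (f m)).
  rewrite /Psi {1}[p]mpolyE linear_sum /=.
  under eq_bigr => m _ do rewrite raddf_sum /= scaler_suml.
  rewrite exchange_big /= big_seq [RHS]big_seq; apply: eq_bigr => m pm.
  have Sfm : f m \in S by rewrite mem_undup map_f.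
  rewrite (bigD1_seq (f m)) ?undup_uniq //= big1 => [|i /negPf neq_i].
    by rewrite addr0 linearZ /= phiX !mcoeffZ mcoeffX eqxx mulr1 scalerA.
  by rewrite linearZ /= phiX !mcoeffZ mcoeffX eq_sym neq_i !mulr0 scale0r.
have -> : p = \sum_(m <- msupp p) (p@_m)%:MP * ('X_[m] - c m *: psi (f m)).
  under eq_bigr => m _ do rewrite mul_mpolyC scalerBr.
  rewrite sumrB -mpolyE -Psi_phi phip0 /Psi.
  by rewrite [X in _ - X]big1 ?subr0 // => m _; rewrite mcoeff0 scale0r.
by apply: ideal_gen_sum => m _; apply: ideal_genM.
Qed.

(** * Exchanging exponents between two rows modulo 2x2 minors *)

Section Exchange.
Variables (A : comNzRingType) (s : seq A).

Lemma ideal_gen_subXX (a b : A) (n : nat) :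
  ideal_gen s (a - b) -> ideal_gen s (a ^+ n - b ^+ n).
Proof. by move=> sab; rewrite subrXX mulrC; apply: ideal_genM. Qed.

(** Replace [(a1 * b2) ^+ j] by [(a2 * b1) ^+ j], then [(a1 * b3) ^+ k] by [(a3 * b1) ^+ k]. *)
Lemma exchange2 (a1 a2 a3 b1 b2 b3 : A) (j k : nat) :
    ideal_gen s (a1 * b2 - a2 * b1) -> ideal_gen s (a1 * b3 - a3 * b1) ->
  ideal_gen s (a1 ^+ (j + k) * b2 ^+ j * b3 ^+ k
               - a2 ^+ j * a3 ^+ k * b1 ^+ (j + k)).
Proof.
move=> /(ideal_gen_subXX j) s12 /(ideal_gen_subXX k) s13.
have -> : a1 ^+ (j + k) * b2 ^+ j * b3 ^+ k - a2 ^+ j * a3 ^+ k * b1 ^+ (j + k)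
   = (a1 * b3) ^+ k * ((a1 * b2) ^+ j - (a2 * b1) ^+ j)
     + (a2 * b1) ^+ j * ((a1 * b3) ^+ k - (a3 * b1) ^+ k).
  by rewrite !exprMn !exprD; ring.
by apply: ideal_genD; apply: ideal_genM.
Qed.

(** With [j = i2' - i2] and [k = i3' - i3], the power of [a1] drops by [j + k]; up to a common
    monomial factor this is [exchange2]. *)
Lemma exchange_le (a1 a2 a3 b1 b2 b3 : A) (i1 i2 i3 j1 j2 j3 : nat)
    (i1' i2' i3' j1' j2' j3' : nat) :
    ideal_gen s (a1 * b2 - a2 * b1) -> ideal_gen s (a1 * b3 - a3 * b1) ->
    (i1 + j1 = i1' + j1')%N -> (i2 + j2 = i2' + j2')%N ->
    (i3 + j3 = i3' + j3')%N -> (i1 + i2 + i3 = i1' + i2' + i3')%N ->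
    (i2 <= i2')%N -> (i3 <= i3')%N ->
  ideal_gen s (a1 ^+ i1 * a2 ^+ i2 * a3 ^+ i3 * (b1 ^+ j1 * b2 ^+ j2 * b3 ^+ j3)
    - a1 ^+ i1' * a2 ^+ i2' * a3 ^+ i3' * (b1 ^+ j1' * b2 ^+ j2' * b3 ^+ j3')).
Proof.
move=> s12 s13 e1 e2 e3 e le2 le3.
have [j ej] : exists j, i2' = (i2 + j)%N by exists (i2' - i2)%N; lia.
have [k ek] : exists k, i3' = (i3 + k)%N by exists (i3' - i3)%N; lia.
have -> : i1 = (i1' + (j + k))%N by lia.
have -> : j1' = (j1 + (j + k))%N by lia.
have -> : j2 = (j2' + j)%N by lia.
have -> : j3 = (j3' + k)%N by lia.
have /(ideal_genM (a1 ^+ i1' * a2 ^+ i2 * a3 ^+ i3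
                   * (b1 ^+ j1 * b2 ^+ j2' * b3 ^+ j3'))) := exchange2 j k s12 s13.
rewrite ej ek; congr ideal_gen.
rewrite !(exprD _ _ (j + k)) !(exprD _ _ j) !(exprD _ _ k).
by ring.
Qed.

(* Of the three exponent differences in the first row, two have the same weak
   sign, and the third column absorbs both. *)
Lemma exchange (a1 a2 a3 b1 b2 b3 : A) (i1 i2 i3 j1 j2 j3 : nat)
    (i1' i2' i3' j1' j2' j3' : nat) :
    ideal_gen s (a1 * b2 - a2 * b1) -> ideal_gen s (a1 * b3 - a3 * b1) ->
    ideal_gen s (a2 * b3 - a3 * b2) ->
    (i1 + j1 = i1' + j1')%N -> (i2 + j2 = i2' + j2')%N ->
    (i3 + j3 = i3' + j3')%N -> (i1 + i2 + i3 = i1' + i2' + i3')%N ->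
  ideal_gen s (a1 ^+ i1 * a2 ^+ i2 * a3 ^+ i3 * (b1 ^+ j1 * b2 ^+ j2 * b3 ^+ j3)
    - a1 ^+ i1' * a2 ^+ i2' * a3 ^+ i3' * (b1 ^+ j1' * b2 ^+ j2' * b3 ^+ j3')).
Proof.
move=> s12 s13 s23.
have s21 : ideal_gen s (a2 * b1 - a1 * b2).
  by rewrite -opprB; apply: ideal_genN.
have s31 : ideal_gen s (a3 * b1 - a1 * b3).
  by rewrite -opprB; apply: ideal_genN.
have s32 : ideal_gen s (a3 * b2 - a2 * b3).
  by rewrite -opprB; apply: ideal_genN.
wlog le12 : i1 i2 i3 j1 j2 j3 i1' i2' i3' j1' j2' j3' /
    [|| (i1 <= i1') && (i2 <= i2'), (i1 <= i1') && (i3 <= i3')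
      | (i2 <= i2') && (i3 <= i3')]%N.
  move=> IH e1 e2 e3 e; have [|gt] := boolP ([|| (i1 <= i1') && (i2 <= i2'),
    (i1 <= i1') && (i3 <= i3') | (i2 <= i2') && (i3 <= i3')])%N.
    by move=> le; apply: IH.
  (* Otherwise at least two exponents of the first row strictly decrease, and swapping the two
     monomials makes them increase. *)
  by rewrite -opprB; apply: ideal_genN; apply: IH; lia.
move=> e1 e2 e3 e; case/or3P: le12 => /andP[le le'].
- have := @exchange_le a3 a1 a2 b3 b1 b2 i3 i1 i2 j3 j1 j2 i3' i1' i2' j3' j1' j2'
    s31 s32 e3 e1 e2 ltac:(lia) le le'.
  by congr ideal_gen; ring.
- have := @exchange_le a2 a1 a3 b2 b1 b3 i2 i1 i3 j2 j1 j3 i2' i1' i3' j2' j1' j3'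
    s21 s23 e2 e1 e3 ltac:(lia) le le'.
  by congr ideal_gen; ring.
exact: exchange_le.
Qed.

End Exchange.

(** * The map to a domain and its kernel *)

Section Parametrization.
Variable K : fieldType.

(* Lists of length 10 follow the order x12, x13, x14, x23, x24, x34, y1, ..,
   y4 of Defs. The vector (x23, -x13, x12) becomes y4 (y1, y2, y3), the old
   variable y4 being sent to 0. *)
Definition param_tuple : 10.-tuple {mpoly K[10]} :=
  [tuple y4 * y3; - (y4 * y2); x14; y4 * y1; x24; x34; y1; y2; y3; 0].

Definition param (p : {mpoly K[10]}) := p \mPo param_tuple.

HB.instance Definition _ := GRing.RMorphism.copy param (comp_mpoly param_tuple).
HB.instance Definition _ := GRing.Linear.copy param (comp_mpoly param_tuple).

Definition mnm10 (s : seq nat) : 'X_{1..10} := [multinom nth 0%N s i | i < 10].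

(** Indexing by [nat] lets exponents be named by numerals; only [i < 10] is meaningful. *)
Definition mexp (m : 'X_{1..10}) (i : nat) : nat := m (inord i).

Lemma mexp_mnm10 s i : (i < 10)%N -> mexp (mnm10 s) i = nth 0%N s i.
Proof. by move=> lti; rewrite /mexp mnmE inordK. Qed.

Lemma prod10 (A : comNzRingType) (F : nat -> A) (m : 'X_{1..10}) :
  \prod_(i < 10) F i ^+ m i =
    F 0 ^+ mexp m 0 * F 1 ^+ mexp m 1 * F 2 ^+ mexp m 2 * F 3 ^+ mexp m 3
    * F 4 ^+ mexp m 4 * F 5 ^+ mexp m 5 * F 6 ^+ mexp m 6 * F 7 ^+ mexp m 7
    * F 8 ^+ mexp m 8 * F 9 ^+ mexp m 9.
Proof.
under eq_bigr => i _ do rewrite -{2}[i]inord_val -/(mexp m i).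
by rewrite !big_ord_recr big_ord0 /= mul1r.
Qed.

Lemma mpolyX10 (m : 'X_{1..10}) : 'X_[m] =
  x12 ^+ mexp m 0 * x13 ^+ mexp m 1 * x14 ^+ mexp m 2 * x23 ^+ mexp m 3
  * x24 ^+ mexp m 4 * x34 ^+ mexp m 5 * y1 ^+ mexp m 6 * y2 ^+ mexp m 7
  * y3 ^+ mexp m 8 * y4 ^+ mexp m 9 :> {mpoly K[10]}.
Proof.
rewrite mpolyXE_id.
under eq_bigr => i _ do rewrite -{1}[i]inord_val.
rewrite (prod10 (fun i => 'X_(inord i))).
have X_inord k (ltk : (k < 10)%N) :
    'X_(inord k) = 'X_(Ordinal ltk) :> {mpoly K[10]}.
  by congr 'X_(_); apply: val_inj; rewrite /= inordK.
rewrite (X_inord 0 isT) (X_inord 1 isT) (X_inord 2 isT) (X_inord 3 isT).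
rewrite (X_inord 4 isT) (X_inord 5 isT) (X_inord 6 isT) (X_inord 7 isT).
by rewrite (X_inord 8 isT) (X_inord 9 isT).
Qed.

Lemma param_gens :
  [/\ param x12 = y4 * y3, param x13 = - (y4 * y2), param x14 = x14,
      param x23 = y4 * y1 & param x24 = x24] /\
  [/\ param x34 = x34, param y1 = y1, param y2 = y2, param y3 = y3
    & param y4 = 0].
Proof.
by split; split; rewrite /param /x12 /x13 /x14 /x23 /x24 /x34
   /y1 /y2 /y3 /y4 comp_mpolyXU.
Qed.

(** The first factor comes from [y4] going to 0, the second from the sign in the image of [x13]. *)
Definition param_sgn (m : 'X_{1..10}) : K :=
  (mexp m 9 == 0%N)%:R * (-1) ^+ mexp m 1.

Definition param_mnm (m : 'X_{1..10}) : 'X_{1..10} :=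
  let e := mexp m in
  mnm10 [:: 0; 0; e 2; 0; e 4; e 5; e 3 + e 6; e 1 + e 7; e 0 + e 8;
            e 0 + e 1 + e 3]%N.

Lemma paramX m : param 'X_[m] = param_sgn m *: 'X_[param_mnm m].
Proof.
have [[p12 p13 p14 p23 p24] [p34 pp1 pp2 pp3 pp4]] := param_gens.
rewrite !mpolyX10 !rmorphM /= !rmorphXn /= p12 p13 p14 p23 p24 p34 pp1 pp2 pp3 pp4.
rewrite !mexp_mnm10 //= expr0n /param_sgn.
case: eqP => [_|_]; last by rewrite mulr0 mul0r scale0r.
rewrite mulr1 mul1r -mul_mpolyC rmorphXn rmorphN1 !exprD exprNn !exprMn !expr0.
by ring.
Qed.

(* Greedy preimage: fill the exponents of x23, then x13, then x12. *)
Definition lift_mnm (m : 'X_{1..10}) : 'X_{1..10} :=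
  let e := mexp m in
  let i1 := minn (e 9) (e 6) in
  let i2 := minn (e 9 - i1) (e 7) in
  let i3 := (e 9 - i1 - i2)%N in
  mnm10 [:: i3; i2; e 2; i1; e 4; e 5; e 6 - i1; e 7 - i2; e 8 - i3; 0]%N.

(** For monomials free of [y4], a common value of [param_mnm] means equal column sums of exponents
    and equal degree in the row [(x23, - x13, x12)]: the hypotheses of [exchange]. *)
Lemma param_ker (p : {mpoly K[10]}) :
  param p = 0 -> ideal_gen [:: g13; g23; g33; y4] p.
Proof.
pose s : seq {mpoly K[10]} := [:: g13; g23; g33; y4].
pose psi m : {mpoly K[10]} :=
  (-1) ^+ mexp (lift_mnm m) 1 *: 'X_[lift_mnm m].
apply: (mpoly_monomial_map_ker (psi := psi) paramX) => m; rewrite /param_sgn.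
have gen i : ideal_gen s s`_i by apply: ideal_gen_nth.
(* A monomial divisible by [y4] has image 0 and is a multiple of the last generator. *)
case: eqP => [m9|/eqP]; last first.
  rewrite -lt0n => m9; rewrite mul0r scale0r subr0 mpolyX10.
  by rewrite -(prednK m9) exprSr mulrA; exact: ideal_genM (gen 3%N).
have s12 : ideal_gen s (x23 * y2 - - x13 * y1).
  have -> : x23 * y2 - - x13 * y1 = - g33 :> {mpoly K[10]} by rewrite /g33; ring.
  by exact: ideal_genN (gen 2%N).
have s13 : ideal_gen s (x23 * y3 - x12 * y1).
  have -> : x23 * y3 - x12 * y1 = g23 :> {mpoly K[10]} by rewrite /g23; ring.
  by exact: (gen 1%N).
have s23 : ideal_gen s (- x13 * y3 - x12 * y2).
  have -> : - x13 * y3 - x12 * y2 = - g13 :> {mpoly K[10]} by rewrite /g13; ring.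
  by exact: ideal_genN (gen 0%N).
rewrite mul1r /psi; set m' := lift_mnm _.
(* The sign is absorbed into the powers of [- x13], the actual matrix entry. *)
have sgn_X (k : 'X_{1..10}) : mexp k 9 = 0%N ->
    (-1) ^+ mexp k 1 *: 'X_[k] =
    x14 ^+ mexp k 2 * x24 ^+ mexp k 4 * x34 ^+ mexp k 5 *
    (x23 ^+ mexp k 3 * (- x13) ^+ mexp k 1 * x12 ^+ mexp k 0
     * (y1 ^+ mexp k 6 * y2 ^+ mexp k 7 * y3 ^+ mexp k 8)) :> {mpoly K[10]}.
  move=> k9; rewrite mpolyX10 k9 -mul_mpolyC rmorphXn rmorphN1 [(- x13) ^+ _]exprNn.
  by ring.
have -> : 'X_[m] = (-1) ^+ mexp m 1 *: ((-1) ^+ mexp m 1 *: 'X_[m]) :> {mpoly K[10]}.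
  by rewrite scalerA -expr2 sqrr_sign scale1r.
rewrite -scalerBr -mul_mpolyC; apply: ideal_genM.
rewrite !sgn_X // ?mexp_mnm10 //= -mulrBr; apply: ideal_genM.
(* In [param_mnm m] the last exponent is at most the sum of those of [y1], [y2], [y3], so the
   truncated subtractions of [lift_mnm] are exact. *)
apply: exchange => //; rewrite ?mexp_mnm10 //=; lia.
Qed.

Lemma param_g44_neq0 : param g44 != 0.
Proof.
have [[_ _ p14 _ p24] [p34 pp1 pp2 pp3 _]] := param_gens.
(* Evaluation at [x14 = y1 = 1], all other variables 0, takes [param g44] to -1. *)
apply/eqP => /(congr1 (meval (fun i : 'I_10 => ((i == 2 :> nat) || (i == 6 :> nat))%:R))).
rewrite /g44 !rmorphB /= !rmorphM /= !rmorphN /= p14 p24 p34 pp1 pp2 pp3.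
rewrite /x14 /x24 /x34 /y1 /y2 /y3 !mevalXU /= meval0.
by move/eqP; rewrite !mul0r !subr0 mulr1 oppr_eq0 oner_eq0.
Qed.

End Parametrization.

(** * The two inclusions for the colon ideal *)

Theorem mainTheorem3 (K : fieldType) (p : {mpoly K[10]}) :
  colon (@I4 K) (@J4 K) p <-> ideal_gen [:: g13; g23; g33; y4] p.
Proof.
split=> [Ip | /ideal_gen_cons[u [_ [/ideal_gen_cons[v [_ [/ideal_gen_cons[w
    [_ [/ideal_gen_cons[t [_ [/ideal_gen_nil -> ->]]] ->]]] ->]]] ->]]]].
  have /ideal_gen_cons[u [_ [/ideal_gen_cons[v [_ [/ideal_gen_cons[w [_
    [/ideal_gen_nil -> ->]]] ->]]]]]] := Ip g44 (ideal_gen_nth [:: g44] 0).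
  have [[p12 p13 p14 p23 p24] [p34 pp1 pp2 pp3 pp4]] := param_gens K.
  move=> /(congr1 (@param K)) /eqP; rewrite rmorphM /=.
  have -> : param (u * g14 + (v * g24 + (w * g34 + 0))) = 0.
    rewrite /g14 /g24 /g34 !(rmorphD, rmorphB, rmorphM, rmorphN, rmorph0) /=.
    rewrite p12 p13 p14 p23 p24 p34 pp1 pp2 pp3 pp4.
    by ring.
  rewrite mulf_eq0 (negPf (param_g44_neq0 K)) orbF => /eqP.
  exact: param_ker.
move=> q /ideal_gen_cons[e [_ [/ideal_gen_nil -> ->]]].
(* Since [g13 = g14 - x14 * y4], and similarly for [g23] and [g33], [h] is the coefficient of [y4]
   once these are traded for [g14], [g24], [g34]. *)
pose h := t - u * x14 - v * x24 - w * x34.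
(* [y4 * g44] lies in [I4] because [Y^T X Y = 0] for skew-symmetric [X]. *)
have -> : (u * g13 + (v * g23 + (w * g33 + (t * y4 + 0)))) * (e * g44 + 0)
  = e * (u * g44 - h * y1) * g14 + e * (v * g44 - h * y2) * g24
    + e * (w * g44 - h * y3) * g34.
  by rewrite /h /g14 /g24 /g34 /g44 /g13 /g23 /g33; ring.
have gen i := ideal_gen_nth [:: g14; g24; g34 : {mpoly K[10]}] i.
by do !apply: ideal_genD; apply: ideal_genM;
   [exact: (gen 0%N) | exact: (gen 1%N) | exact: (gen 2%N)].
Qed.
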